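(* Let $(\mathcal{R},\leq)$ be a Strassen preordered commutative semiring with asymptotic spectrum $\mathcal{X}$, and let $f\colon\mathcal{R}\to\mathbb{R}_{\geq0}$ be monotone, superadditive, supermultiplicative, monomially homogeneous, and monomially dominant. Then there exists a nonempty closed subset $\mathcal{Z}\subseteq\mathcal{X}$ such that $f(a)=\min_{\phi\in\mathcal{Z}}\phi(a)$ for all $a\in\mathcal{R}$. Moreover, one can take $\mathcal{Z}=\{\phi\in\mathcal{X}:\phi(a)\geq f(a)\text{ for all }a\in\mathcal{R}\}$.
   Context: $\mathcal{R}$ is a commutative semiring with $0,1$; naturals $n$ denote $1+\cdots+1$. A Strassen preorder satisfies: $0\leq a$; $a\leq b$ implies $a+c\leq b+c$ and $ac\leq bc$; every nonzero $a$ has $1\leq a\leq n$ for some $n\in\mathbb{N}$; $n\leq m$ in $\mathcal{R}$ iff in $\mathbb{N}$. $\mathcal{X}$ is the set of maps $\phi\colon\mathcal{R}\to\mathbb{R}_{\geq0}$ that are normalized ($\phi(1)=1$), additive, multiplicative and monotone, with the topology of pointwise convergence. $f$ is monotone if $a\leq b\Rightarrow f(a)\leq f(b)$; superadditive if $f(a+b)\geq f(a)+f(b)$; supermultiplicative if $f(ab)\geq f(a)f(b)$; monomially homogeneous if $f(ma^n)=mf(a)^n$ for all $m,n\in\mathbb{N}$; monomially dominant if for all $s,t\in\mathcal{R}$ there exist $k=k(n)\in\{0,\dots,n\}$ such that $\binom{n}{k}f(s^kt^{n-k})\geq 2^{-o(n)}f(s+t)^n$ as $n\to\infty$. *)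

(* Defs.v *)
From HB Require Import structures.
From mathcomp Require Import all_boot all_order all_algebra.
From mathcomp Require Import all_classical all_reals all_analysis.

Set Implicit Arguments.
Unset Strict Implicit.
Unset Printing Implicit Defensive.

Import Order.TTheory GRing.Theory Num.Theory.
Import numFieldNormedType.Exports.

Local Open Scope classical_set_scope.
Local Open Scope ring_scope.

Record strassen_preorder (S : comPzSemiRingType) (le : S -> S -> Prop) : Prop :=
  StrassenPreorder {
    strassen_refl : forall a, le a a;
    strassen_trans : forall a b c, le a b -> le b c -> le a c;
    strassen_ge0 : forall a, le 0 a;
    strassen_leD : forall a b c, le a b -> le (a + c) (b + c);
    strassen_leM : forall a b c, le a b -> le (a * c) (b * c);
    strassen_bounded : forall a, a != 0 ->
      exists n : nat, le 1 a /\ le a n%:R;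
    strassen_natr : forall m n : nat, le m%:R n%:R <-> (m <= n)%N }.

(* A map with values in the nonnegative reals is a real-valued map satisfying
   [map_nonneg]; the topology on R_{>= 0} is the one induced by R. *)
Section Properties.
Context {R : realType} {S : comPzSemiRingType}.
Implicit Types f : S -> R.

Definition map_nonneg f := forall a, 0 <= f a.

Definition map_monotone (le : S -> S -> Prop) f :=
  forall a b, le a b -> f a <= f b.

Definition map_additive f := forall a b, f (a + b) = f a + f b.

Definition map_multiplicative f := forall a b, f (a * b) = f a * f b.

Definition map_superadditive f := forall a b, f a + f b <= f (a + b).

Definition map_supermultiplicative f := forall a b, f a * f b <= f (a * b).

(* The naturals include 0, and x ^+ 0 = 1 for every x; the case n = 0 reads
   f m = m, and excludes the zero map. *)
Definition monomially_homogeneous f :=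
  forall (m n : nat) (a : S), f (m%:R * a ^+ n) = m%:R * f a ^+ n.

Definition monomially_dominant f :=
  forall s t : S, exists (k : nat -> nat) (e : nat -> R),
    [/\ forall n, (k n <= n)%N,
        e =o_\oo (fun n => n%:R : R)
      & \forall n \near \oo,
          2 `^ (- e n) * f (s + t) ^+ n
            <= 'C(n, k n)%:R * f (s ^+ k n * t ^+ (n - k n))].

End Properties.

Definition asymptotic_spectrum (R : realType) (S : comPzSemiRingType)
    (le : S -> S -> Prop) : set {ptws S -> R} :=
  [set phi | [/\ map_nonneg phi, phi 1 = 1, map_additive phi,
                 map_multiplicative phi & map_monotone le phi]].

(* For Z `<=` X, being closed in [subspace X] is being closed in X for the
   topology induced by that of pointwise convergence. *)
Definition closed_in_spectrum (R : realType) (S : comPzSemiRingType)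
    (le : S -> S -> Prop) (Z : set {ptws S -> R}) :=
  Z `<=` asymptotic_spectrum le /\
  closed (Z : set (subspace (asymptotic_spectrum le : set {ptws S -> R}))).

Definition is_minimum (R : realType) (A : set R) (x : R) := A x /\ lbound A x.

Definition min_representation (R : realType) (S : comPzSemiRingType)
    (le : S -> S -> Prop) (f : S -> R) (Z : set {ptws S -> R}) :=
  [/\ Z !=set0, closed_in_spectrum le Z
    & forall a, is_minimum [set phi a | phi in Z] (f a)].

(* Main.v *)
(* The relation [x << y] iff [f (x c + d) <= f (y c + d)] for all [c, d] is a
   semiring preorder containing [le], and monomial dominance gives [m << b^n]
   whenever [m <= f(b)^n], so every character monotone for [<<] dominates [f].
   To make the value at [a0] equal to [f a0], take a maximal semiring preorder
   [P] containing [<<] such that [m P q a0^n] forces [m <= q f(a0)^n]. If neither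
   [a P b] nor [b P a], then adjoining either relation breaks this condition;
   adding the two failures, with suitable weights, cancels [a] and [b] up to a
   common summand, and high powers of the result contradict the condition for
   [P] itself. So [P] is total, and [a |-> sup {m / n : m P n a}] is the
   character sought. *)

Require Import Defs.
From HB Require Import structures.
From mathcomp Require Import all_boot all_order all_algebra.
From mathcomp Require Import all_classical all_reals all_analysis.
From mathcomp Require Import ring lra.

Import Order.TTheory GRing.Theory Num.Theory.
Import numFieldNormedType.Exports.

Local Open Scope classical_set_scope.
Local Open Scope ring_scope.

(** * Real inequalities from asymptotic estimates *)

Lemma le_of_multiples {R : realType} {x y} (C : R) :
  (forall n, n%:R * x <= n%:R * y + C) -> x <= y.
Proof.
move=> h; rewrite leNgt; apply/negP => yx.
set n := (Num.trunc (C / (x - y))).+1.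
have : C < n%:R * (x - y) by rewrite -ltr_pdivrMr ?subr_gt0// truncnS_gt.
by have := h n; lra.
Qed.

Lemma bernoulli_exp {R : realType} {d : R} (k : nat) :
  0 <= d -> 1 + k%:R * d <= (1 + d) ^+ k.
Proof.
move=> d0; elim: k => [|k ih]; first by rewrite mul0r addr0 expr0.
have k0 : 0 <= k%:R * d * d by rewrite !mulr_ge0.
rewrite exprS; apply: (@le_trans _ _ ((1 + d) * (1 + k%:R * d))).
  by rewrite -natr1; lra.
by rewrite ler_pM2l//; lra.
Qed.

(** If [0 < y < x], Bernoulli makes [(x / y) ^+ n] outgrow any constant; for [y = 0] the case
    [k = 1] suffices. *)
Lemma le_of_powers {R : realType} {x y} (C : R) :
  0 <= y -> (forall k, x ^+ k <= C * y ^+ k) -> x <= y.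
Proof.
move=> y0 h; rewrite leNgt; apply/negP => yx.
have [y0'|y0'] := eqVneq y 0.
  by have := h 1%N; rewrite !expr1 y0' mulr0 => ?; lra.
have yp : 0 < y by rewrite lt_neqAle eq_sym y0'.
suff : x / y - 1 <= 0 by rewrite subr_le0 ler_pdivrMr// mul1r leNgt yx.
apply: (le_of_multiples C) => n; rewrite mulr0 add0r.
have d0 : 0 <= x / y - 1 by rewrite subr_ge0 ler_pdivlMr// mul1r ltW.
have := bernoulli_exp n d0.
rewrite (addrC 1 (x / y - 1)) subrK expr_div_n => hb.
have : x ^+ n / y ^+ n <= C by rewrite ler_pdivrMr ?exprn_gt0.
by lra.
Qed.

(* The exponential error of [monomially_dominant] disappears when taking n-th roots. *)
Lemma le_of_subexponential {R : realType} {x y : R} (e : nat -> R) :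
  0 <= x -> 0 <= y -> e =o_\oo (fun n => n%:R : R) ->
  (\forall n \near \oo, 2 `^ (- e n) * x ^+ n <= y ^+ n) -> x <= y.
Proof.
move=> x0 y0 /eqoP eo h.
apply: (le_of_multiples x) => -[|n]; first by rewrite !mul0r add0r.
set d : R := n.+1%:R^-1.
have d0 : 0 < d by rewrite invr_gt0.
(* After multiplication by [n.+1], the factor [1 - d] costs only the constant additive error [x]. *)
suff : x * (1 - d) <= y.
  move=> /(ler_wpM2l (ler0n R n.+1)).
  by rewrite mulrBr mulr1 mulrBr mulrCA divff// mulr1; lra.
near \oo => N.
have N0 : (0 < N)%N by near: N; exists 1%N.
have eN : e N <= d * N%:R.
  apply: le_trans (ler_norm _) _; rewrite -[N%:R]ger0_norm//.
  by near: N; exact: eo.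
have hN : 2 `^ (- e N) * x ^+ N <= y ^+ N by near: N.
(* The left side is a lower bound because [expR (- d * ln 2) >= 1 - d * ln 2] and [ln 2 <= 1]. *)
have two : 1 - d <= 2 `^ (- d) :> R.
  rewrite /powR pnatr_eq0/=; apply: le_trans (expR_ge1Dx _).
  have l2 : ln (2 : R) <= 1.
    by apply: (@le_ln1Dx R 1); lra.
  have : d * ln 2 <= d * 1 by rewrite ler_pM2l.
  by lra.
apply: (@le_trans _ _ (2 `^ (- d) * x)).
  by rewrite mulrC ler_wpM2r.
rewrite -(@ler_pXn2r _ N)// ?nnegrE ?mulr_ge0 ?powR_ge0//.
apply: le_trans hN; rewrite exprMn ler_wpM2r ?exprn_ge0//.
rewrite -powR_mulrn ?powR_ge0// -powRrM ler_powR//; lra.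
Unshelve. all: end_near.
Qed.

(** * Semiring preorders *)

Record semiring_preorder {S : comPzSemiRingType} (P : S -> S -> Prop) : Prop :=
  SemiringPreorder {
    spre_refl : forall a, P a a;
    spre_trans : forall a b c, P a b -> P b c -> P a c;
    spre_add : forall a b c, P a b -> P (a + c) (b + c);
    spre_mul : forall a b c, P a b -> P (a * c) (b * c) }.

Arguments spre_trans {S P} _ {a} b {c}.
Arguments spre_add {S P} _ {a b} c _.
Arguments spre_mul {S P} _ {a b} c _.

Section SemiringPreorder.
Context {S : comPzSemiRingType} {P : S -> S -> Prop}.
Hypothesis hP : semiring_preorder P.

Lemma spre_addl {a b} c : P a b -> P (c + a) (c + b).
Proof. by move=> h; rewrite ![c + _]addrC; apply: spre_add. Qed.

Lemma spre_mull {a b} c : P a b -> P (c * a) (c * b).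
Proof. by move=> h; rewrite ![c * _]mulrC; apply: spre_mul. Qed.

Lemma spre_addD {a b c d} : P a b -> P c d -> P (a + c) (b + d).
Proof.
move=> ab cd; apply: (spre_trans hP (b + c)); first exact: spre_add.
exact: spre_addl.
Qed.

Lemma spre_mulM {a b c d} : P a b -> P c d -> P (a * c) (b * d).
Proof.
move=> ab cd; apply: (spre_trans hP (b * c)); first exact: spre_mul.
exact: spre_mull.
Qed.

Lemma spre_exp {a b} k : P a b -> P (a ^+ k) (b ^+ k).
Proof.
move=> ab; elim: k => [|k ih]; first by rewrite !expr0; apply: spre_refl.
by rewrite !exprS; apply: spre_mulM.
Qed.

(** The summand [u] acts as a catalyst: it is recovered each time an [a] is exchanged for a [b], so
    one copy serves all [q] exchanges. *)
Lemma spre_iter_add {a b u} q : P (a + u) (b + u) -> P (q%:R * a + u) (q%:R * b + u).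
Proof.
move=> ab; elim: q => [|q ih]; first by rewrite !mul0r; apply: spre_refl.
apply: (spre_trans hP (q%:R * b + u + a)).
  have -> : q.+1%:R * a + u = q%:R * a + u + a by rewrite -natr1; ring.
  exact: spre_add.
have -> : q%:R * b + u + a = q%:R * b + (a + u) by ring.
have -> : q.+1%:R * b + u = q%:R * b + (b + u) by rewrite -natr1; ring.
exact: spre_addl.
Qed.

(** As a semiring preorder, this relation passes to powers: the k-th powers are compared with still
    a single factor [v], and only the summand [u] changes with [k]. *)
Lemma spre_cancel_weak (v : S) :
  semiring_preorder (fun x y => exists u, P (x * v + u) (y * v + u)).
Proof.
split.
- by move=> a; exists 0; apply: spre_refl.
- move=> a b c [u ab] [w bc]; exists (u + w).
  rewrite !addrA; apply: (spre_trans hP (b * v + u + w)); first exact: spre_add.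
  by rewrite ![_ + u + w]addrAC; apply: spre_add.
- move=> a b c [u ab]; exists u.
  by rewrite !mulrDl ![_ + _ * v + u]addrAC; apply: spre_add.
- move=> a b c [u ab]; exists (u * c).
  by rewrite ![_ * c * v]mulrAC -!mulrDl; apply: spre_mul.
Qed.

(* The semiring preorder generated by [P] and the relation [b <= a]. *)
Definition spre_adjoin (a b : S) x y := exists s, P (x + s * a) (y + s * b).

Lemma spre_adjoin_pre a b : semiring_preorder (spre_adjoin a b).
Proof.
split.
- by move=> x; exists 0; rewrite !mul0r; apply: spre_refl.
- move=> x y z [s xy] [t yz]; exists (s + t); rewrite !mulrDl.
  apply: (spre_trans hP (y + s * b + t * a)).
    by rewrite addrA; apply: spre_add.
  rewrite addrAC (_ : z + _ = z + t * b + s * b); last ring.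
  exact: spre_add.
- move=> x y c [s xy]; exists s.
  by rewrite ![_ + c + _]addrAC; apply: spre_add.
- move=> x y c [s xy]; exists (s * c).
  by rewrite ![s * c * _]mulrAC -!mulrDl; apply: spre_mul.
Qed.

Lemma spre_adjoin_sub a b x y : P x y -> spre_adjoin a b x y.
Proof. by exists 0; rewrite !mul0r !addr0. Qed.

Lemma spre_adjoinE a b : spre_adjoin a b b a.
Proof. by exists 1; rewrite !mul1r addrC; apply: spre_refl. Qed.

End SemiringPreorder.

Lemma strassen_semiring_preorder {S : comPzSemiRingType} {le : S -> S -> Prop} :
  strassen_preorder le -> semiring_preorder le.
Proof. by case=> r t _ d m _ _; split. Qed.

(** * The character of a total preorder *)

Section TotalPreorder.
Context {R : realType} {S : comPzSemiRingType} {P : S -> S -> Prop}.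
Hypothesis hP : semiring_preorder P.
Hypothesis P_ge0 : forall a, P 0 a.
Hypothesis P_bounded : forall a, exists n : nat, P a n%:R.
Hypothesis P_nat : forall m n : nat, P m%:R n%:R -> (m <= n)%N.
Hypothesis P_total : forall a b, P a b \/ P b a.

Definition lower_fractions (a : S) : set R :=
  [set x | exists m n : nat,
     [/\ (0 < n)%N, x = m%:R / n%:R & P m%:R (n%:R * a)]].

Definition total_character (a : S) : R := sup (lower_fractions a).

Lemma lower_fractions_ub a m n : (0 < n)%N -> P (n%:R * a) m%:R ->
  ubound (lower_fractions a) (m%:R / n%:R).
Proof.
move=> n0 am _ [m' [n' [n'0 -> ma]]].
rewrite ler_pdivrMr ?ltr0n// mulrAC ler_pdivlMr ?ltr0n//.
rewrite -!natrM ler_nat; apply: P_nat; rewrite !natrM.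
apply: (spre_trans hP (n'%:R * a * n%:R)); first exact: spre_mul.
have -> : n'%:R * a * n%:R = n%:R * a * n'%:R by ring.
exact: spre_mul.
Qed.

Lemma lower_fractions_has_sup a : has_sup (lower_fractions a).
Proof.
split; first by exists 0, 0%N, 1%N; split; rewrite ?mul0r//; exact: P_ge0.
have [n an] := P_bounded a; exists (n%:R / 1%:R).
by apply: lower_fractions_ub => //; rewrite mul1r.
Qed.

Lemma total_character_lower m n a :
  P m%:R (n%:R * a) -> m%:R <= n%:R * total_character a.
Proof.
case: n => [|n] ma.
  have : (m <= 0)%N by apply: P_nat; move: ma; rewrite mul0r.
  by rewrite leqn0 => /eqP ->; rewrite mul0r.
rewrite mulrC -ler_pdivrMr ?ltr0n//; apply: sup_upper_bound.
  exact: lower_fractions_has_sup.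
by exists m, n.+1.
Qed.

Lemma total_character_upper m n a :
  P (n%:R * a) m%:R -> n%:R * total_character a <= m%:R.
Proof.
case: n => [|n] am; first by rewrite mul0r.
rewrite mulrC -ler_pdivlMr ?ltr0n//; apply: ge_sup.
  by case: (lower_fractions_has_sup a).
exact: lower_fractions_ub.
Qed.

Lemma total_character_ge0 a : 0 <= total_character a.
Proof. by have := @total_character_lower 0 1 a; rewrite !mul1r; apply. Qed.

(** The first integer above [n%:R * total_character a] cannot lie below [n%:R * a] in [P], so
    totality puts it above. *)
Lemma total_character_above n a : exists m : nat,
  P (n%:R * a) m%:R /\ m%:R <= n%:R * total_character a + 1.
Proof.
have na0 : 0 <= n%:R * total_character a by rewrite mulr_ge0// total_character_ge0.
have /andP[h1 h2] := truncn_itv na0.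
exists (Num.trunc (n%:R * total_character a)).+1.
split; last by rewrite -natr1; lra.
set m := (Num.trunc _).+1 in h2 *.
have [//|/total_character_lower] := P_total (n%:R * a) m%:R.
by rewrite leNgt h2.
Qed.

Lemma total_character_below n a : exists m : nat,
  P m%:R (n%:R * a) /\ n%:R * total_character a <= m%:R + 1.
Proof.
have [m [am hm]] := total_character_above n a.
(* Take the largest integer below [n%:R * a]; by totality its successor is then above. *)
have [m' [am' hm']] : exists m' : nat,
    P m'%:R (n%:R * a) /\ forall k : nat, P k%:R (n%:R * a) -> (k <= m')%N.
  pose A k := `[< P k%:R (n%:R * a) >].
  have exA : exists k, A k by exists 0%N; apply/asboolP; exact: P_ge0.
  have ubA k : A k -> (k <= m)%N.
    by move=> /asboolP ka; apply: P_nat; apply: spre_trans ka am.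
  have [k /asboolP ka kmax] := ex_maxnP exA ubA.
  by exists k; split=> // j ja; apply: kmax; apply/asboolP.
exists m'; split=> //; rewrite natr1; apply: total_character_upper.
by have [/hm'|//] := P_total m'.+1%:R (n%:R * a); rewrite ltnn.
Qed.

Lemma total_characterD : map_additive total_character.
Proof.
move=> a b; apply/eqP; rewrite eq_le; apply/andP; split.
  apply: (le_of_multiples 2) => n.
  have [m [am hm]] := total_character_above n a.
  have [m' [bm' hm']] := total_character_above n b.
  have : P (n%:R * (a + b)) (m + m')%N%:R by rewrite mulrDr natrD; apply: spre_addD.
  by move/total_character_upper; rewrite natrD; lra.
apply: (le_of_multiples 2) => n.
have [m [am hm]] := total_character_below n a.
have [m' [bm' hm']] := total_character_below n b.
have : P (m + m')%N%:R (n%:R * (a + b)) by rewrite mulrDr natrD; apply: spre_addD.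
by move/total_character_lower; rewrite natrD; lra.
Qed.

Lemma total_characterM : map_multiplicative total_character.
Proof.
move=> a b; set x := total_character a; set y := total_character b.
have x0 : 0 <= x := total_character_ge0 a.
have y0 : 0 <= y := total_character_ge0 b.
have dist n : n%:R * a * (n%:R * b) = (n * n)%N%:R * (a * b) by rewrite natrM; ring.
apply/eqP; rewrite eq_le; apply/andP; split.
  (* With [N = n.+1], the product [(N x + 1)(N y + 1)] exceeds [N^2 x y] by [N (x + y) + 1], which
     is at most [x + y + 1] after division by [N]. *)
  apply: (le_of_multiples (x + y + 1)) => -[|n]; first by rewrite !mul0r; lra.
  have [m [am hm]] := total_character_above n.+1 a.
  have [m' [bm' hm']] := total_character_above n.+1 b.
  have : P ((n.+1 * n.+1)%N%:R * (a * b)) (m * m')%N%:R.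
    by rewrite -dist natrM; apply: spre_mulM.
  move/total_character_upper; rewrite !natrM => h.
  have : m%:R * m'%:R <= (n.+1%:R * x + 1) * (n.+1%:R * y + 1) by rewrite ler_pM.
  have N1 : 1 <= n.+1%:R :> R by rewrite ler1n.
  have N0 : 0 < n.+1%:R :> R by rewrite ltr0n.
  by move=> h'; rewrite -(ler_pM2l N0); nra.
apply: (le_of_multiples (x + y + 1)) => -[|n]; first by rewrite !mul0r; lra.
have [m [am hm]] := total_character_below n.+1 a.
have [m' [bm' hm']] := total_character_below n.+1 b.
have : P (m * m')%N%:R ((n.+1 * n.+1)%N%:R * (a * b)).
  by rewrite -dist natrM; apply: spre_mulM.
move/total_character_lower; rewrite !natrM => h.
have xm := @total_character_lower _ _ _ am.
have ym := @total_character_lower _ _ _ bm'.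
have N1 : 1 <= n.+1%:R :> R by rewrite ler1n.
have N0 : 0 < n.+1%:R :> R by rewrite ltr0n.
have : n.+1%:R * x * (n.+1%:R * y) <= (m%:R + 1) * (m'%:R + 1).
  by rewrite ler_pM// mulr_ge0// ltW.
rewrite -/x -/y in xm ym.
by move=> h'; rewrite -(ler_pM2l N0); nra.
Qed.

Lemma total_character_nat n : total_character n%:R = n%:R.
Proof.
apply/eqP; rewrite eq_le; apply/andP; split.
  have := @total_character_upper n 1 n%:R; rewrite !mul1r; apply.
  exact: spre_refl.
have := @total_character_lower n 1 n%:R; rewrite !mul1r; apply.
exact: spre_refl.
Qed.

Lemma total_character_mono : map_monotone P total_character.
Proof.
move=> a b ab; apply: (le_of_multiples 1) => n.
have [m [bm hm]] := total_character_above n b.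
apply: le_trans hm; apply: total_character_upper.
by apply: spre_trans bm => //; apply: spre_mull.
Qed.

End TotalPreorder.

(** * Maximal preorders *)

Definition subrelation {T : Type} (P Q : T -> T -> Prop) :=
  forall a b, P a b -> Q a b.

(* A character monotone for [P] with value at most [r] at [a0] can exist only if
   this holds; conversely, for total [P] this bounds the value at [a0] by [r]. *)
Definition asymptotically_bounded {R : realType} {S : comPzSemiRingType}
    (a0 : S) (r : R) (P : S -> S -> Prop) :=
  forall m q n : nat, (0 < q)%N -> (0 < n)%N ->
    P m%:R (q%:R * a0 ^+ n) -> m%:R <= q%:R * r ^+ n.

Definition admissible {R : realType} {S : comPzSemiRingType}
    (B : S -> S -> Prop) (a0 : S) (r : R) (P : S -> S -> Prop) :=
  [/\ semiring_preorder P, subrelation B P & asymptotically_bounded a0 r P].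

Section MaximalExtension.
Context {R : realType} {S : comPzSemiRingType} {B : S -> S -> Prop}.
Context {a0 : S} {r : R}.
Hypothesis hB : semiring_preorder B.

(** Zorn's lemma: each clause of admissibility has at most two instances of the relation as
    premises, and these lie in one member of a chain, so the union of a nonempty chain is
    admissible. *)
Lemma admissible_maximal : asymptotically_bounded a0 r B ->
  exists2 P, admissible B a0 r P &
    forall Q, admissible B a0 r Q -> subrelation P Q -> subrelation Q P.
Proof.
move=> bB.
pose T := {P : S -> S -> Prop | admissible B a0 r P}.
pose leT : rel T := fun P Q => `[< subrelation (sval P) (sval Q) >].
have B_adm : admissible B a0 r B by split.
pose T0 : T := exist _ B B_adm.
have leT_refl t : leT t t by apply/asboolP.
have leT_trans (x y z : T) : leT x y -> leT y z -> leT x z.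
  by move=> /asboolP xy /asboolP yz; apply/asboolP => a b /xy /yz.
have [A totA|[P aP] maxP] := ZL_preorder T0 leT_refl leT_trans.
  have [[X0 AX0]|A0] := pselect (A !=set0); last first.
    by exists T0 => s As; case: A0; exists s.
  pose U (a b : S) := exists2 X, A X & sval X a b.
  have U2 a b c d : U a b -> U c d -> exists2 X, A X & sval X a b /\ sval X c d.
    move=> [X AX ab] [Y AY cd].
    have [/asboolP XY|/asboolP YX] := totA X Y AX AY.
      by exists Y => //; split=> //; exact: XY.
    by exists X => //; split=> //; exact: YX.
  have U_adm : admissible B a0 r U.
    split.
    - split.
      + by move=> a; exists X0 => //; case: (svalP X0) => h _ _; apply: spre_refl.
      + move=> a b c ab bc; have [X AX [ab' bc']] := U2 _ _ _ _ ab bc.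
        by exists X => //; case: (svalP X) => h _ _; apply: spre_trans bc'.
      + move=> a b c [X AX ab]; exists X => //.
        by case: (svalP X) => h _ _; apply: spre_add.
      + move=> a b c [X AX ab]; exists X => //.
        by case: (svalP X) => h _ _; apply: spre_mul.
    - by move=> a b ab; exists X0 => //; case: (svalP X0) => _ h _; apply: h.
    - by move=> m q n q0 n0 [X AX h]; case: (svalP X) => _ _; apply.
  by exists (exist _ U U_adm) => s As; apply/asboolP => a b sab; exists s.
exists P => // Q aQ PQ.
by have /asboolP := maxP (exist _ Q aQ) (asboolT PQ).
Qed.

Context {P : S -> S -> Prop}.
Hypothesis hP : semiring_preorder P.
Hypothesis P_ge0 : forall a, P 0 a.
Hypothesis P_bounded : forall a, a != 0 -> exists n : nat, P 1 a /\ P a n%:R.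
Hypothesis a0_ge1 : P 1 a0.
Hypothesis r_ge0 : 0 <= r.
Hypothesis P_abounded : asymptotically_bounded a0 r P.

Lemma spre_leq (m n : nat) : (m <= n)%N -> P m%:R n%:R.
Proof.
move=> mn; rewrite -(subnK mn) natrD -[X in P X _]add0r.
exact: spre_add.
Qed.

Lemma spre_boundedW a : exists n : nat, P a n%:R.
Proof.
have [->|/P_bounded[n [_ h]]] := eqVneq a 0; last by exists n.
by exists 0%N; apply: spre_refl.
Qed.

(** Since [1] is below [a0], [m ^ k] is below [n ^ k * a0]; the bound gives [m ^ k <= n ^ k * r],
    and [r] disappears on taking k-th roots. *)
Lemma admissible_nat {m n : nat} : P m%:R n%:R -> (m <= n)%N.
Proof.
move=> mn; rewrite -(ler_nat R); case: n mn => [|n] mn.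
  (* The bound requires a positive coefficient, so [n = 0] is separate: a positive [m] below [0]
     would put every integer below [0], hence below [a0], and [r] would bound them all. *)
  rewrite leNgt; apply/negP; rewrite ltr0n => m0.
  suff : forall k, k%:R <= r by move/(_ (Num.trunc r).+1); rewrite leNgt truncnS_gt.
  move=> k; have := @P_abounded k 1 1; rewrite !mul1r !expr1; apply => //.
  apply: (spre_trans hP 1) => //.
  apply: (spre_trans hP 0); last exact: P_ge0.
  apply: (spre_trans hP (k%:R * m%:R)).
    by rewrite -natrM; apply: spre_leq; rewrite leq_pmulr.
  by rewrite -[X in P _ X](mulr0 k%:R); apply: spre_mull.
apply: (le_of_powers r) => // k.
rewrite -!natrX mulrC -[r]expr1; apply: P_abounded => //; first by rewrite expn_gt0.
rewrite expr1 !natrX -[X in P X _]mulr1.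
by apply: spre_mulM => //; exact: spre_exp.
Qed.

Lemma adjoin_not_bounded a b :
  ~ asymptotically_bounded a0 r (spre_adjoin (P := P) a b) ->
  exists m q n : nat, [/\ (0 < q)%N, (0 < n)%N, q%:R * r ^+ n < m%:R &
    spre_adjoin (P := P) a b m%:R (q%:R * a0 ^+ n)].
Proof.
move=> h; apply: contrapT => h'; apply: h => m q n q0 n0 hm.
by rewrite leNgt; apply/negP => lt; apply: h'; exists m, q, n.
Qed.

(** Powers and positive multiples preserve a violation of the bound; this brings two violations to
    the same coefficient and the same exponent of [a0]. *)
Lemma violation_exp {Q : S -> S -> Prop} {m q n k c : nat} :
  semiring_preorder Q -> (0 < k)%N -> (0 < c)%N ->
  q%:R * r ^+ n < m%:R -> Q m%:R (q%:R * a0 ^+ n) ->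
  (q ^ k * c)%N%:R * r ^+ (n * k)%N < (m ^ k * c)%N%:R /\
  Q (m ^ k * c)%N%:R ((q ^ k * c)%N%:R * a0 ^+ (n * k)%N).
Proof.
move=> hQ k0 c0 lt hm; split.
  rewrite !natrM !natrX mulrAC exprM -exprMn ltr_pM2r ?ltr0n//.
  by rewrite ltr_pXn2r// nnegrE// mulr_ge0// exprn_ge0.
rewrite !natrM !natrX mulrAC exprM -exprMn.
by apply: spre_mul => //; apply: spre_exp.
Qed.

(* Taking powers amplifies a gap [q r^n < m] until the factor [v] and the common
   summand [u] no longer matter. *)
Lemma bounded_no_common_violation (m q n : nat) (v u : S) : v != 0 ->
  (0 < q)%N -> (0 < n)%N ->
  P (m%:R * v + u) (q%:R * a0 ^+ n * v + u) -> m%:R <= q%:R * r ^+ n.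
Proof.
move=> v0 q0 n0 muv.
have [M [v1 vM]] := P_bounded v v0.
(* [M] bounds the factor [v], and the extra 1 absorbs the common summand. *)
apply: (le_of_powers M.+1%:R); first by rewrite mulr_ge0// exprn_ge0.
have powers (k : nat) : (0 < k)%N -> m%:R ^+ k <= M.+1%:R * (q%:R * r ^+ n) ^+ k.
  move=> k0.
  have [w mw] := spre_exp (spre_cancel_weak hP v) k (ex_intro _ u muv).
  have [W wW] := spre_boundedW w.
  have b1 : P 1 ((q%:R * a0 ^+ n) ^+ k).
    rewrite -[X in P X _](expr1n S k); apply: spre_exp => //.
    rewrite -[X in P X _]mulr1; apply: spre_mulM => //; first exact: (spre_leq 1 q q0).
    by rewrite -[X in P X _](expr1n S n); apply: spre_exp.
  (* With [W.+1] copies of the main terms a single [w] remains, and [w] is below [W.+1], hence below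
     [W.+1] times the k-th power on the right, which is at least 1. *)
  have key : P (W.+1%:R * m%:R ^+ k) (W.+1%:R * M.+1%:R * (q%:R * a0 ^+ n) ^+ k).
    set x := m%:R ^+ k in mw *; set y := (_ * _) ^+ k in mw b1 *.
    apply: (spre_trans hP (W.+1%:R * (x * v) + w)).
      rewrite -[X in P X _]addr0; apply: spre_addD => //.
      rewrite -[x in P x _]mulr1 -mulrA; do 2 apply: spre_mull => //.
    apply: (spre_trans hP (W.+1%:R * (y * v) + w)).
      exact: spre_iter_add.
    have -> : W.+1%:R * M.+1%:R * y = W.+1%:R * (y * M%:R) + W.+1%:R * y.
      by rewrite -[M.+1%:R]natr1; ring.
    apply: spre_addD => //; first by do 2 apply: spre_mull => //.
    apply: (spre_trans hP W.+1%:R).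
      by apply: spre_trans wW _ => //; exact: spre_leq.
    by rewrite -[X in P X _]mulr1; apply: spre_mull.
  rewrite -(@ler_pM2l _ W.+1%:R)// mulrA.
  have := @P_abounded (W.+1 * m ^ k)%N (W.+1 * M.+1 * q ^ k)%N (n * k)%N.
  rewrite !natrM !natrX !exprM -!mulrA -!exprMn; apply.
  - by rewrite !muln_gt0/= expn_gt0 q0.
  - by rewrite muln_gt0 n0.
  - by rewrite mulrA.
move=> [|k]; last exact: powers.
by rewrite !expr0 mulr1 ler1n.
Qed.

Lemma bounded_adjoin a b :
  asymptotically_bounded a0 r (spre_adjoin (P := P) a b) \/
  asymptotically_bounded a0 r (spre_adjoin (P := P) b a).
Proof.
apply: contrapT => /not_orP[/adjoin_not_bounded[m [q [n [q0 n0 lt hm]]]]].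
move=> /adjoin_not_bounded[m' [q' [n' [q'0 n'0 lt' hm']]]].
have c0 : (0 < q' ^ n)%N by rewrite expn_gt0 q'0.
have c'0 : (0 < q ^ n')%N by rewrite expn_gt0 q0.
have [] := violation_exp (spre_adjoin_pre hP a b) n'0 c0 lt hm.
have [] := violation_exp (spre_adjoin_pre hP b a) n0 c'0 lt' hm'.
rewrite (mulnC n') (mulnC (q' ^ n)%N).
set d := (q ^ n' * q' ^ n)%N; set N := (n * n')%N.
have d0 : (0 < d)%N by rewrite muln_gt0 c0 c'0.
have N0 : (0 < N)%N by rewrite muln_gt0 n0.
set p' := (m' ^ n * _)%N; set p := (m ^ n' * _)%N => lp' [s' hs'] lp [s hs].
(* Both violations now have right side [d%:R * a0 ^+ N]; lowering both left sides to the minimum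
   keeps them violations. *)
pose p0 := minn p p'.
have lp0 : d%:R * r ^+ N < p0%:R by rewrite /p0 /minn; case: ifP.
have {}hs : P (p0%:R + s * a) (d%:R * a0 ^+ N + s * b).
  apply: spre_trans hs => //; apply: spre_add => //.
  by apply: spre_leq; rewrite geq_minl.
have {}hs' : P (p0%:R + s' * b) (d%:R * a0 ^+ N + s' * a).
  apply: spre_trans hs' => //; apply: spre_add => //.
  by apply: spre_leq; rewrite geq_minr.
suff : p0%:R <= d%:R * r ^+ N by rewrite leNgt lp0.
(* For [s = 0] the first violation already holds in [P]. *)
have [s0|s0] := eqVneq s 0.
  by move: hs; rewrite s0 !mul0r !addr0; exact: P_abounded.
have ss0 : s + s' != 0.
  apply/eqP => ss; have [_ [s1 _]] := P_bounded s s0.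
  have : P 1%:R 0%:R.
    rewrite -[X in P _ X]ss; apply: (spre_trans hP s) => //.
    by rewrite -[X in P X _]addr0; apply: spre_addl.
  by move/admissible_nat.
(* Weighting the first relation by [s'] and the second by [s] leaves the cross terms [s * s' * a]
   and [s * s' * b] on both sides of the sum. *)
apply: (@bounded_no_common_violation _ _ _ (s + s') (s * s' * (a + b))) => //.
have := spre_addD hP (spre_mul hP s' hs) (spre_mul hP s hs').
set x := d%:R * _; congr P; ring.
Qed.

End MaximalExtension.

(** * Minimum representation *)

Section Functional.
Context {R : realType} {S : comPzSemiRingType} {le : S -> S -> Prop}.
Hypothesis hle : strassen_preorder le.
Context {f : S -> R}.
Hypothesis f_ge0 : map_nonneg f.
Hypothesis f_mono : map_monotone le f.
Hypothesis f_superM : map_supermultiplicative f.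
Hypothesis f_homo : monomially_homogeneous f.
Hypothesis f_dom : monomially_dominant f.

Lemma homogeneous_scale (m : nat) a : f (m%:R * a) = m%:R * f a.
Proof. by have := f_homo m 1 a; rewrite !expr1. Qed.

Lemma homogeneous_exp a n : f (a ^+ n) = f a ^+ n.
Proof. by have := f_homo 1 n a; rewrite !mul1r. Qed.

Lemma homogeneous_nat (m : nat) : f m%:R = m%:R.
Proof. by have := f_homo m 0 0; rewrite !expr0 !mulr1. Qed.

Lemma binomial_term_le (x y : S) {n k} : (k <= n)%N ->
  le ('C(n, k)%:R * (x ^+ k * y ^+ (n - k))) ((x + y) ^+ n).
Proof.
move=> kn; have hP := strassen_semiring_preorder hle.
have kn' : (k < n.+1)%N by [].
rewrite addrC exprDn (bigD1 (Ordinal kn'))//=.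
rewrite mulr_natl [y ^+ _ * _]mulrC -[X in le X _]addr0.
by apply: spre_addl => //; exact: strassen_ge0.
Qed.

(* The largest semiring preorder for which [f] is monotone. *)
Definition functional_preorder (x y : S) :=
  forall c d, f (x * c + d) <= f (y * c + d).

Lemma functional_preorder_pre : semiring_preorder functional_preorder.
Proof.
split=> [x c d|x y z xy yz c d|x y e xy c d|x y e xy c d] //.
- exact: le_trans (yz c d).
- by rewrite !mulrDl -!addrA.
- by rewrite -!mulrA.
Qed.

Lemma functional_preorder_sub : subrelation le functional_preorder.
Proof.
move=> x y xy c d; have hP := strassen_semiring_preorder hle.
by apply: f_mono; apply: spre_add => //; apply: spre_mul.
Qed.

(** Dominance bounds [f (m c + d) ^+ N], up to a subexponential factor, by one binomial term.
    Homogeneity extracts [m ^ k], which is at most [f (b ^+ n) ^+ k]; supermultiplicativity puts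
    this back inside [f], giving a term of the expansion of [(b ^+ n * c + d) ^+ N]. *)
Lemma functional_preorder_pow {m n : nat} {b} :
  m%:R <= f b ^+ n -> functional_preorder m%:R (b ^+ n).
Proof.
move=> mb c d; have [k [e [kn eo dom]]] := f_dom (m%:R * c) d.
apply: (le_of_subexponential e) => //.
apply: filterS dom => N /le_trans; apply.
rewrite -homogeneous_exp; apply: le_trans (f_mono _ _ (binomial_term_le _ _ (kn N))).
rewrite homogeneous_scale ler_wpM2l//.
rewrite !exprMn -!mulrA -natrX homogeneous_scale.
apply: (@le_trans _ _ (f b ^+ n ^+ k N * f (c ^+ k N * d ^+ (N - k N)))).
  by rewrite ler_wpM2r// natrX lerXn2r ?nnegrE// exprn_ge0.
by rewrite -!homogeneous_exp; exact: f_superM.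
Qed.

Lemma functional_preorder_bounded a :
  asymptotically_bounded a (f a) functional_preorder.
Proof.
move=> m q n _ _ /(_ 1 0); rewrite !mulr1 !addr0.
by rewrite homogeneous_nat homogeneous_scale homogeneous_exp.
Qed.

Lemma exists_spectral_point a0 : a0 != 0 -> exists phi : {ptws S -> R},
  [/\ asymptotic_spectrum le phi, forall a, f a <= phi a & phi a0 = f a0].
Proof.
move=> a00.
have [P [hP BP P_abounded] maxP] :=
  admissible_maximal functional_preorder_pre (functional_preorder_bounded a0).
have lP : subrelation le P by move=> a b /functional_preorder_sub/BP.
have P_ge0 a : P 0 a by apply: lP; exact: strassen_ge0.
have P_bd a : a != 0 -> exists n : nat, P 1 a /\ P a n%:R.
  by move=> /(strassen_bounded hle)[n [h1 h2]]; exists n; split; exact: lP.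
have [_ [a01 _]] := P_bd a0 a00.
have P_nat := admissible_nat hP P_ge0 a01 P_abounded.
have P_total a b : P a b \/ P b a.
  (* By maximality, an adjoined relation that keeps the bound was already in [P]. *)
  have adj x y : asymptotically_bounded a0 (f a0) (spre_adjoin (P := P) x y) -> P y x.
    move=> h; apply: (maxP (spre_adjoin (P := P) x y)); last exact: spre_adjoinE.
      split=> //; first exact: spre_adjoin_pre.
      by move=> u v /BP; exact: spre_adjoin_sub.
    by move=> u v; exact: spre_adjoin_sub.
  by have [/adj|/adj] := bounded_adjoin hP P_ge0 P_bd a01 (f_ge0 a0) P_abounded a b; tauto.
have P_bdW a : exists n : nat, P a n%:R by exact: spre_boundedW.
pose phi : S -> R := total_character (P := P).
have phi_nat n : phi n%:R = n%:R by exact: total_character_nat.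
have phiM : map_multiplicative phi by exact: total_characterM.
have phi_ge0 a : 0 <= phi a by exact: total_character_ge0.
have phi_mono : map_monotone P phi by exact: total_character_mono.
have phiX a n : phi (a ^+ n) = phi a ^+ n.
  elim: n => [|n ih]; first by rewrite !expr0 -[1]/(1%:R) phi_nat.
  by rewrite !exprS phiM ih.
have f_le a : f a <= phi a.
  (* The constant 2 pays for rounding [f a ^+ n.+1] down to an integer: the loss is below 1, and
     [1 <= phi a ^+ n.+1] when [a] is nonzero. *)
  apply: (le_of_powers 2) => // -[|n]; first by rewrite !expr0; lra.
  have [a0'|a_neq0] := eqVneq a 0.
    suff -> : f a = 0 by rewrite expr0n/= mulr_ge0// exprn_ge0.
    by rewrite a0'; have := homogeneous_nat 0.
  have fa0 : 0 <= f a ^+ n.+1 by rewrite exprn_ge0.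
  have /andP[h1 h2] := truncn_itv fa0.
  have := phi_mono _ _ (BP _ _ (functional_preorder_pow h1)).
  rewrite phi_nat phiX.
  have : 1 <= phi a ^+ n.+1.
    rewrite exprn_ege1//; have [_ [a1 _]] := P_bd a a_neq0.
    by have := phi_mono _ _ a1; rewrite -[1]/(1%:R) phi_nat.
  by move: h2; rewrite -natr1; lra.
exists phi; split=> //.
  split=> //; [exact: phi_nat 1%N|exact: total_characterD|].
  by move=> a b /lP; exact: phi_mono.
apply/eqP; rewrite eq_le f_le andbT.
(* The bound on [P] with exponent 1 applies to the best integer below [n.+1%:R * a0]. *)
apply: (le_of_multiples 1) => -[|n]; first by rewrite !mul0r; lra.
have [m [hm]] := total_character_below (R := R) hP P_ge0 P_bdW P_nat P_total n.+1 a0.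
move/le_trans; apply; rewrite lerD2r.
by have := P_abounded m n.+1 1%N; rewrite !expr1; apply.
Qed.

End Functional.

(** The set is an intersection of preimages of closed half-lines under the evaluations, which are
    continuous for pointwise convergence. *)
Lemma closed_superlevel {R : realType} {S : Type} (f : S -> R) :
  closed [set phi : {ptws S -> R} | forall a, f a <= phi a].
Proof.
have -> : [set phi : {ptws S -> R} | forall a, f a <= phi a] =
    \bigcap_(a in [set: S]) ((fun phi : {ptws S -> R} => phi a) @^-1`
      [set x | f a <= x]).
  by apply/seteqP; split=> [phi h a _|phi h a]; [exact: h|exact: (h a I)].
apply: closed_bigI => a _; apply: preimage_closed; last exact: closed_ge.
move=> phi _; exact: (@proj_continuous {classic S} (fun=> R) a phi).
Qed.

Theorem theorem3p9 (R : realType) (S : comPzSemiRingType)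
    (le : S -> S -> Prop) (hle : strassen_preorder le) (f : S -> R)
    (f_ge0 : map_nonneg f)
    (f_mono : map_monotone le f)
    (f_superD : map_superadditive f)
    (f_superM : map_supermultiplicative f)
    (f_homo : monomially_homogeneous f)
    (f_dom : monomially_dominant f) :
  (exists Z : set {ptws S -> R}, min_representation le f Z) /\
  min_representation le f
    [set phi : {ptws S -> R} |
      asymptotic_spectrum le phi /\ forall a, f a <= phi a].
Proof.
set Z := [set phi | _].
suff hZ : min_representation le f Z by split=> //; exists Z.
have point a : a != 0 -> exists2 phi, Z phi & phi a = f a.
  move=> /(exists_spectral_point hle f_ge0 f_mono f_superM f_homo f_dom).
  by move=> [phi [X_phi f_phi phia]]; exists phi.
have one0 : (1 : S) != 0.
  apply/eqP => one0; have /(strassen_natr hle 1 0) // : le 1 0.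
  by rewrite one0; exact: strassen_ge0.
have [phi1 Zphi1 _] := point _ one0.
split; first by exists phi1.
  split; first by move=> phi [].
  apply/closed_subspaceP; exists [set phi | forall a, f a <= phi a].
    exact: closed_superlevel.
  by apply/seteqP; split=> phi /=; [case=> ? ?|case=> -[]]; split.
move=> a; split; last by move=> _ [phi [_ f_phi] <-].
(* At [a = 0] any member of [Z] attains the minimum, since additive maps vanish there and so does
   [f]. *)
have [->|/point[phi Zphi <-]] := eqVneq a 0; last by exists phi.
exists phi1 => //; case: Zphi1 => -[_ _ phiD _ _] _.
have -> : f 0 = 0 by have := f_homo 0 0 0; rewrite !mul0r.
by have := phiD 0 0; rewrite addr0; lra.
Qed.
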